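(* Let $k\ge 4$ be an even integer. For a prime $\ell$ and $m\in\mathbb{N}$ let $\zeta_{\ell^m}=e^{2\pi i/\ell^m}$ and let $A_{\ell^m}$ be the subfield of $\mathbb{Q}(\zeta_{\ell^m})$ of degree $\frac{\varphi(\ell^m)}{\gcd(k-1,\varphi(\ell^m))}$ over $\mathbb{Q}$. Then for every prime $\ell$ and every $m\in\mathbb{N}$ we have $A_{\ell^m}\subseteq A_{\ell^{m+1}}$. Further, $A_{\ell^m}=A_\ell$ for $m\le \nu_\ell(k-1)+1$, and $[A_{\ell^{m+1}}:A_{\ell^m}]=\ell$ for $m\ge\nu_\ell(k-1)+1$, where $\nu_\ell$ denotes the $\ell$-adic valuation.
   Context: $\mathbb{N}$ is the set of positive integers and $\varphi$ is Euler's totient function. The subfield $A_{\ell^m}$ is unique: for odd $\ell$ the group $\mathrm{Gal}(\mathbb{Q}(\zeta_{\ell^m})/\mathbb{Q})\cong(\mathbb{Z}/\ell^m\mathbb{Z})^\times$ is cyclic, and for $\ell=2$ one has $\gcd(k-1,\varphi(2^m))=1$ since $k-1$ is odd, so that $A_{2^m}=\mathbb{Q}(\zeta_{2^m})$. *)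

(* Defs.v *)
From HB Require Import structures.
From mathcomp Require Import all_boot all_order all_algebra.
From mathcomp Require Import complex.
From mathcomp Require Import all_classical all_reals all_analysis.

Set Implicit Arguments.
Unset Strict Implicit.
Unset Printing Implicit Defensive.

Import Order.TTheory GRing.Theory Num.Theory.
Local Open Scope classical_set_scope.
Local Open Scope ring_scope.

(* e^(2 pi i / n), written cos + i sin because the library has no complex
   exponential. *)
Definition zeta (R : realType) (n : nat) : R[i] :=
  (cos (2 * pi / n%:R) +i* sin (2 * pi / n%:R))%C.

Definition subfield (C : fieldType) (K : set C) : Prop :=
  divring_closed (mem K).

Definition ratfield (C : fieldType) : set C := range (@ratr C).
Arguments ratfield : clear implicits.

(* Every subfield of a field of characteristic 0 contains the rationals, so the
   smallest subfield containing z is Q(z). *)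
Definition Qadjoin (C : fieldType) (z : C) : set C :=
  smallest (@subfield C) [set z].

(* [K : F] = n. The uniqueness of the coordinates (at x = 0, for instance) is
   the linear independence of b over F. *)
Definition has_degree (C : fieldType) (F K : set C) (n : nat) : Prop :=
  [/\ subfield F, subfield K, F `<=` K &
      exists2 b : 'I_n -> C, (forall i, K (b i)) &
        forall x, K x -> exists! c : {ffun 'I_n -> C},
          (forall i, F (c i)) /\ x = \sum_(i < n) c i * b i].

Definition is_Afield (R : realType) (k l m : nat) (K : set R[i]) : Prop :=
  [/\ subfield K, K `<=` Qadjoin (zeta R (l ^ m)) &
      has_degree (ratfield R[i]) K
        (totient (l ^ m) %/ gcdn (k - 1) (totient (l ^ m)))].

(* "The" field satisfying is_Afield, selected by choice. The default set0 is not
   a subfield, so it can never stand in for a missing one. *)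
Definition Afield (R : realType) (k l m : nat) : set R[i] :=
  xget set0 [set K | is_Afield k l m K].
Arguments Afield : clear implicits.

(* Main.v *)
Require Import Defs.
From HB Require Import structures.
From mathcomp Require Import all_boot all_order all_algebra.
From mathcomp Require Import all_fingroup all_solvable all_field lra.
From mathcomp Require Import complex.
From mathcomp Require Import all_classical all_reals all_analysis.

(** Fix a prime l and write a = k - 1, which is odd. All the fields A_(l^m) with
    m <= M lie in the single cyclotomic field Q(zeta_(l^M)), so every assertion
    is a statement about the subfields of one number field and their degrees.

    The degrees are explicit: splitting a into its l-part and the rest shows
    that phi(l^(m+1)) / gcd(a, phi(l^(m+1))) = c * l^(m - nu_l(a)), where c does
    not depend on m and the subtraction is truncated at 0
    ([totient_ppower_div_gcd]). Hence the degrees form a divisibility chain that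
    is constant up to m = nu_l(a) + 1 and is multiplied by l at each later step.

    For odd l the group Gal(Q(zeta_(l^M))/Q) embeds into the cyclic group of
    units of Z/l^M ([cyclotomic_gal_cyclic]). In a cyclic group the subgroups
    are ordered by divisibility of their orders, so by the Galois correspondence
    the subfields of Q(zeta_(l^M)) are ordered by divisibility of their degrees
    ([cyclic_galois_subv]), and every divisor of the degree occurs
    ([cyclic_galois_dim]). For l = 2 the Galois group need not be cyclic, but a
    is odd, so A_(2^m) is all of Q(zeta_(2^m)). In both cases A_(l^m) is
    contained in A_(l^(m+1)), with equality as soon as the degrees agree, and
    the relative degree is the quotient of the degrees.

    Galois theory is carried out in an abstract splitting field L of the
    cyclotomic polynomial over the rationals, together with an embedding f of L
    into the complex numbers whose image is Q(zeta_(l^M)) ([cyclotomic_field],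
    [Qadjoin_image]). Subfields of the image correspond to subfields of L
    ([subfield_preimage]), and degrees over subsets of the complex numbers to
    dimensions in L ([has_degree_image], [has_degree_dim]). *)

Set Implicit Arguments.
Unset Strict Implicit.
Unset Printing Implicit Defensive.

Import Order.TTheory GRing.Theory Num.Theory.
Local Open Scope classical_set_scope.
Local Open Scope ring_scope.

(** * Cyclotomic fields embedded in a given field *)

(** The minimal polynomial of an algebraic primitive n-th root of unity is known
    to be the n-th cyclotomic polynomial, and minimal polynomials are
    irreducible. *)
Lemma Cyclotomic_irreducible n :
  (0 < n)%N -> irreducible_poly (map_poly (intr : int -> rat) 'Phi_n).
Proof.
move=> n_gt0; have [z prim_z] := C_prim_root_exists n_gt0.
have [r [Dr mon_r] dv_r] := minCpolyP z.
have ->: map_poly intr 'Phi_n = r.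
  apply: (map_inj_poly (fmorph_inj (@ratr algC)) (rmorph0 _)).
  rewrite -Dr (minCpoly_cyclotomic prim_z) -(Cintr_Cyclotomic prim_z).
  by rewrite -map_poly_comp; apply: eq_map_poly => a; rewrite /= rmorph_int.
have nz_r := monic_neq0 mon_r.
have rz0: root (map_poly ratr r) z by rewrite dv_r.
by apply/(subfx_irreducibleP rz0 nz_r)=> q qz0 nzq; rewrite dvdp_leq // -dv_r.
Qed.

(** A root of 'X^n - 1 is a root of 'Phi_d for some d dividing n, hence of
    'X^d - 1; primitivity excludes d < n. This holds in every field, so that it
    can be applied to the roots of unity given by cosines and sines. *)
Lemma prim_root_Cyclotomic (F : fieldType) n (z : F) :
  n.-primitive_root z -> root (map_poly intr 'Phi_n) z.
Proof.
move=> prim_z; have n_gt0 := prim_order_gt0 prim_z.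
have mapXn1 d : map_poly (intr : int -> F) ('X^d - 1) = 'X^d - 1.
  by rewrite rmorphB /= rmorph1 map_polyXn.
have rootXn1 d : root ('X^d - 1) z = (n %| d)%N.
  by rewrite rootE !hornerE subr_eq0 (prim_order_dvd prim_z).
have: root (map_poly (intr : int -> F) (\prod_(d <- divisors n) 'Phi_d)) z.
  by rewrite prod_Cyclotomic // mapXn1 rootXn1.
rewrite rmorph_prod /= rootE horner_prod prodf_seq_eq0.
case/hasP=> d d_n /= rz.
have d_gt0 : (0 < d)%N by rewrite -dvdn_divisors // in d_n; apply: dvdn_gt0 d_n.
(* 'Phi_d divides 'X^d - 1, so z has order dividing d. *)
have: root ('X^d - 1) z.
  rewrite -mapXn1 -prod_Cyclotomic // (big_rem d) -?dvdn_divisors //=.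
  by rewrite rmorphM rootM; apply/orP; left.
rewrite rootXn1 => n_d; rewrite -dvdn_divisors // in d_n.
by have/eqP-> : n == d by rewrite eqn_dvd n_d.
Qed.

Lemma cyclotomic_splitting (F : fieldType) (L : fieldExtType F) n (w : L) :
  n.-primitive_root w -> <<1; w>>%VS = fullv -> splitting_field_axiom L.
Proof.
move=> prim_w gen_w; exists ('X^n - 1).
  by rewrite rpredB ?rpred1 // rpredX // polyOverX.
exists [seq w ^+ i | i <- index_iota 0 n].
  by rewrite big_map -(factor_Xn_sub_1 prim_w) eqpxx.
apply/eqP; rewrite eqEsubv subvf -gen_w /=.
apply/FadjoinP; split; first exact: sub1v.
have n_gt0 := prim_order_gt0 prim_w.
apply: seqv_sub_adjoin; apply/mapP; exists (1 %% n)%N.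
  by rewrite mem_index_iota ltn_pmod.
by rewrite -{1}(expr1 w) (prim_expr_mod prim_w).
Qed.

(** The field is L = Q[X] / ('Phi_n), embedded by sending X to z: it has degree
    phi(n) because 'Phi_n is irreducible, and it is a splitting field because
    the powers of one primitive root are all the roots of 'X^n - 1. *)
Lemma cyclotomic_field (C : numFieldType) n (z : C) :
  n.-primitive_root z ->
  exists (L : splittingFieldType rat) (f : {rmorphism L -> C}) (w : L),
    [/\ f w = z, <<1; w>>%VS = fullv & \dim {:L} = totient n].
Proof.
move=> prim_z; have n_gt0 := prim_order_gt0 prim_z.
have irr := Cyclotomic_irreducible n_gt0; set p := map_poly _ _ in irr.
have nz_p := irredp_neq0 irr.
have pz0 : root (map_poly (@ratr C) p) z.
  rewrite -map_poly_comp (eq_map_poly (g := intr)); last first.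
    by move=> a; rewrite /= rmorph_int.
  exact: prim_root_Cyclotomic.
pose L0 : fieldExtType rat := SubFieldExtType pz0 irr.
pose f : {rmorphism L0 -> C} := @subfx_inj rat C ratr z p.
pose w : L0 := @subfx_root rat C ratr z p.
have fw : f w = z by exact: subfx_inj_root.
have gen_w : <<1; w>>%VS = fullv.
  apply/vspaceP=> x; rewrite memvf; have [q ->] := subfxEroot pz0 nz_p x.
  apply/Fadjoin_polyP; exists (map_poly (in_alg L0) q) => //.
  by apply/polyOverP=> i; rewrite coef_map memvZ ?mem1v.
have prim_w : n.-primitive_root w by rewrite -(fmorph_primitive_root f) fw.
pose L : splittingFieldType rat :=
  HB.pack L0
    (FieldExt_isSplittingField.Build rat L0
      (cyclotomic_splitting prim_w gen_w)).
exists L, f, w; split=> //.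
transitivity (size p).-1; first by rewrite dimvf.
by rewrite size_map_inj_poly ?size_Cyclotomic //; exact: intr_inj.
Qed.

(** * Cyclicity of the Galois group for odd prime powers *)

(** The units of Z/n are the automorphisms of a cyclic group of order n, and the
    automorphism group of a cyclic p-group is cyclic when p is odd. *)
Lemma units_Zp_odd_cyclic p m :
  prime p -> odd p -> cyclic (units_Zp (p ^ m.+1)).
Proof.
move=> p_pr p_odd; set n := (p ^ m.+1)%N.
have n_gt1 : (1 < n)%N.
  by rewrite -(exp1n m.+1) ltn_exp2r ?prime_gt1.
pose a : 'Z_n := Zp1.
have oa : #[a]%g = n by rewrite order_Zp1 /= Zp_cast.
rewrite -oa (isog_cyclic (Zp_unit_isog a)).
have pG : (p.-group <[a]>)%g by rewrite /pgroup -orderE oa pnatX pnat_id.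
have ntG : (<[a]>%G :!=: 1)%g by rewrite -cardG_gt1 -orderE oa.
have [m' [_ [_ cycF _ _]]] :=
  cyclic_pgroup_Aut_structure pG (cycle_cyclic a) ntG.
(* A group of order p is treated apart: its automorphism group equals its
   p'-core, which is cyclic. *)
case: ifP => [_ AF|_ [t [_ _ _]]]; first by move: cycF; rewrite -AF.
by rewrite p_odd => -[[]].
Qed.

(** An automorphism s is determined by the exponent u(s) with s w = w ^+ u(s),
    and u is multiplicative, so u embeds the Galois group into the units of
    Z/p^(m+1). *)
Lemma cyclotomic_gal_cyclic (F : fieldType) (L : splittingFieldType F) p m
    (w : L) :
  prime p -> odd p -> (p ^ m.+1).-primitive_root w -> <<1; w>>%VS = fullv ->
  cyclic 'Gal({:L} / 1)%g.
Proof.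
move=> p_pr p_odd; have := units_Zp_odd_cyclic m p_pr p_odd.
have n_gt1 : (1 < p ^ m.+1)%N.
  by rewrite -(exp1n m.+1) ltn_exp2r ?prime_gt1.
set n := (p ^ m.+1)%N in n_gt1 * => cycU prim_w gen_w.
have expP (s : gal_of {:L}) : exists u : {unit 'Z_n}, s w = w ^+ val u.
  have prim_sw : n.-primitive_root (s w) by rewrite fmorph_primitive_root.
  have [i si] := prim_rootP prim_w (prim_expr_order prim_sw).
  have Ui : (i%:R : 'Z_n) \is a GRing.unit.
    by rewrite unitZpE // coprime_sym -(prim_root_exp_coprime i prim_w) -si.
  by exists (FinRing.Unit Ui); rewrite /= val_Zp_nat // modn_small.
have [u uE] := fin_all_exists expP.
have uM : {in 'Gal({:L} / 1)%g &, {morph u : s t / (s * t)%g}}.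
  move=> s t _ _; apply: val_inj; apply: val_inj => /=.
  have lt_n (x : {unit 'Z_n}) : (val x < n)%N.
    by rewrite -[X in (_ < X)%N](Zp_cast n_gt1) ltn_ord.
  have : w ^+ val (u (s * t)%g) = w ^+ (val (u s) * val (u t))%N.
    by rewrite -uE galM ?memvf // uE rmorphXn /= uE mulnC exprM.
  move/eqP; rewrite (eq_prim_root_expr prim_w) modn_small // => /eqP->.
  by congr (_ %% _)%N; rewrite Zp_cast.
have inj_u : ('injm (Morphism uM))%g.
  apply/injmP=> s t _ _ /= us; apply/eqP/gal_eqP=> x.
  move=> _; have := memvf x; rewrite -gen_w.
  move=> /Fadjoin_polyP[_ /polyOver1P[q ->] ->].
  have fix_q (r : gal_of {:L}) :
      map_poly r (map_poly (in_alg L) q) = map_poly (in_alg L) q.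
    by rewrite -map_poly_comp; apply: eq_map_poly => a; rewrite /= rmorph_alg.
  by rewrite -!horner_map !fix_q /= !uE us.
rewrite -(injm_cyclic inj_u (subxx _)); apply: cyclicS cycU.
by apply/fintype.subsetP=> x _; rewrite inE.
Qed.

(** * Subfields of a cyclic extension *)

Section CyclicGalois.

Variables (F0 : fieldType) (L : splittingFieldType F0) (K E : {subfield L}).
Hypotheses (galKE : galois K E) (cycKE : cyclic 'Gal(E / K)%g).

(** In a cyclic group, subgroup inclusion is divisibility of orders; the Galois
    correspondence reverses both the inclusion and the divisibility. *)
Lemma cyclic_galois_subv (M1 M2 : {subfield L}) :
    (K <= M1 <= E)%VS -> (K <= M2 <= E)%VS -> (\dim M1 %| \dim M2)%N ->
  (M1 <= M2)%VS.
Proof.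
move=> /andP[KM1 M1E] /andP[KM2 M2E] dv.
have gal1 : galois M1 E by apply: galoisS galKE; rewrite KM1.
have gal2 : galois M2 E by apply: galoisS galKE; rewrite KM2.
rewrite -(galois_fixedField gal1) -(galois_fixedField gal2).
apply: fixedFieldS; rewrite -(cardSg_cyclic cycKE) ?galS //.
rewrite -!galois_dim //.
have /dvdnP[a ->] := field_dimS M2E; rewrite mulnK ?adim_gt0 //.
by have /dvdnP[c ->] := dv; rewrite mulnA mulnK ?adim_gt0 // dvdn_mulr.
Qed.

(** The field fixed by the d-th power of a generator of the Galois group has
    degree d, the index of the subgroup generated by that power. *)
Lemma cyclic_galois_dim d :
    (d %| \dim_K E)%N ->
  exists M : {subfield L}, (K <= M <= E)%VS /\ \dim_K M = d.
Proof.
move=> dvd_d; have KE : (K <= E)%VS by case/andP: galKE.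
have [x defG] := cyclicP cycKE.
have oG : \dim_K E = #[x]%g by rewrite galois_dim // defG.
have sXG : (<[x ^+ d]> \subset 'Gal(E / K))%g by rewrite defG cycleX.
exists (fixedField <[x ^+ d]>%g)%AS; split.
  by rewrite -galois_connection ?sXG ?fixedField_bound.
rewrite (dim_fixed_galois galKE sXG) -divgS // -galois_dim // oG.
by rewrite oG in dvd_d; rewrite -orderE orderXdiv // divnA // mulKn.
Qed.

End CyclicGalois.

Lemma galois_rat (L : splittingFieldType rat) : galois 1 {:L}.
Proof.
apply/and3P; split; [exact: sub1v | | exact: normalFieldf].
apply/separableP=> x _; apply: pcharf0_separable => p.
by rewrite -(pchar_num rat) -(fmorph_pchar (in_alg L)).
Qed.

(** * Subfields given as sets and as subspaces *)

(** Packaging a subfield as a closed predicate makes the closure lemmas for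
    rational numbers and polynomial evaluation available. *)
Lemma subfield_divring (C : fieldType) (K : set C) :
  subfield K -> exists S : divringClosed C, forall x, (x \in S) <-> K x.
Proof.
move=> KP; pose S : divringClosed C :=
  HB.pack (mem K : {pred C}) (GRing.isDivringClosed.Build C (mem K) KP).
by exists S => x; split=> [/set_mem|/mem_set].
Qed.

Section Image.

Variables (C : numFieldType) (L : fieldExtType rat) (f : {rmorphism L -> C}).

Lemma rmorph_ratr a : f a%:A = ratr a.
Proof. by rewrite -[LHS]/((f \o in_alg L) a) fmorph_eq_rat. Qed.

Lemma subfield_image (E : {subfield L}) : subfield (f @` [set` E]).
Proof.
split.
- by apply/mem_set; exists 1; rewrite ?rmorph1 //=; exact: mem1v.
- move=> _ _ /set_mem[x /= Ex <-] /set_mem[y /= Ey <-].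
  by apply/mem_set; exists (x - y); rewrite ?rmorphB //=; exact: memvB.
- move=> _ _ /set_mem[x /= Ex <-] /set_mem[y /= Ey <-].
  apply/mem_set; exists (x / y); rewrite ?fmorph_div //=.
  by rewrite memvM ?memvV.
Qed.

Lemma ratfield_image : ratfield C = f @` [set` 1%AS].
Proof.
apply/seteqP; split=> [_ [a _ <-] | _ [_ /vlineP[a ->] <-]].
  by exists a%:A; rewrite ?rmorph_ratr //= memvZ ?mem1v.
by exists a; rewrite ?rmorph_ratr.
Qed.

Lemma range_image : range f = f @` [set` {:L}%AS].
Proof. by congr (f @` _); apply/seteqP; split=> x //= _; exact: memvf. Qed.

Lemma image_subv (E F : {subfield L}) :
  (E <= F)%VS -> f @` [set` E] `<=` f @` [set` F].
Proof. by move=> /subvP EF; apply: image_subset => x /= /EF. Qed.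

(** Every element of L is a rational polynomial in w. *)
Lemma image_generator (w : L) (K : set C) :
  <<1; w>>%VS = fullv -> subfield K -> K (f w) -> range f `<=` K.
Proof.
move=> gen_w /subfield_divring[S KS] Kw _ [x _ <-].
have := memvf x; rewrite -gen_w => /Fadjoin_polyP[_ /polyOver1P[q ->] ->].
rewrite -horner_map -map_poly_comp (eq_map_poly (g := ratr)); last first.
  by move=> a /=; rewrite rmorph_ratr.
apply/KS; apply: rpred_horner; last exact/KS.
by apply/polyOverP => i; rewrite coef_map rpred_rat.
Qed.

Lemma Qadjoin_image (w : L) :
  <<1; w>>%VS = fullv -> Qadjoin (f w) = range f.
Proof.
move=> gen_w; apply/seteqP; split.
  apply: smallest_sub; last by move=> _ ->; exists w.
  by rewrite range_image; exact: subfield_image.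
move=> y ry K [subK Kw]; apply: (image_generator gen_w subK) ry.
exact: Kw.
Qed.

(** Take a subfield E of L of maximal dimension among those mapped into K. If x
    is mapped into K then so is E(x), whose elements are the polynomials in x
    over E; maximality then gives E(x) = E, so x lies in E. *)
Lemma subfield_preimage (K : set C) :
    subfield K -> K `<=` range f ->
  exists E : {subfield L}, K = f @` [set` E].
Proof.
move=> /[dup] subK /subfield_divring[S KS] Kf.
pose P n := `[< exists2 E : {subfield L}, f @` [set` E] `<=` K & \dim E = n >].
have exP : exists n, P n.
  exists (\dim (1%AS : {subfield L})); apply/asboolP; exists 1%AS => //.
  by rewrite -ratfield_image => _ [a _ <-]; apply/KS; rewrite rpred_rat.
have leP n : P n -> (n <= \dim {:L})%N.
  by move=> /asboolP[E _ <-]; rewrite dimvS ?subvf.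
case: (ex_maxnP exP leP) => _ /asboolP[E EK <-] maxE; exists E.
apply/seteqP; split=> // y Kx; have [x _ fx] := Kf _ Kx; exists x => //=.
rewrite -{}fx in Kx.
have: f @` [set` <<E; x>>%AS] `<=` K.
  move=> _ [_ /Fadjoin_polyP[q Eq ->] <-]; rewrite -horner_map /=.
  apply/KS; apply: rpred_horner; last exact/KS.
  apply/polyOverP=> i; rewrite coef_map /=; apply/KS/EK.
  by exists q`_i => //=; move/polyOverP: Eq.
move=> ExK; have leEx : (\dim <<E; x>> <= \dim E)%N.
  by apply: maxE; apply/asboolP; exists <<E; x>>%AS.
have /eqP-> : (E == <<E; x>> :> {vspace L})%VS.
  by rewrite eqEdim subv_adjoin.
exact: memv_adjoin.
Qed.

(** As E is a field, the E-module F is a direct sum of lines E X_i; the images of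
    the X_i form the required basis. *)
Lemma has_degree_image (E F : {subfield L}) :
  (E <= F)%VS -> has_degree (f @` [set` E]) (f @` [set` F]) (\dim_E F).
Proof.
move=> EF; have EF_F : (E * F <= F)%VS.
  by rewrite (subv_trans (prodvSl _ EF)) ?asubv.
split; [exact: subfield_image | exact: subfield_image | exact: image_subv |].
have [X [XF nzX] [defF dxX]] := field_module_semisimple EF_F.
exists (fun i => f (tnth X i)).
  by move=> i; exists (tnth X i) => //=; apply: XF; exact: mem_tnth.
move=> _ [x /= Fx <-].
have nzXi i : tnth X i != 0 by apply: contraNneq nzX => <-; exact: mem_tnth.
have XE (i : 'I_(\dim_E F)) : X`_i = tnth X i by rewrite (tnth_nth 0).
have: x \in (\sum_(i < \dim_E F) E * <[X`_i]>)%VS by rewrite defF.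
case/memv_sumP => y Ey Dx.
have /fin_all_exists2[a Ea Da] i : exists2 a, a \in E & y i = a * tnth X i.
  by have /memv_cosetP[a Ea ->] := Ey i isT; exists a; rewrite ?XE.
exists [ffun i => f (a i)]; split.
  split=> [i|]; first by rewrite ffunE; exists (a i) => //=; exact: Ea.
  rewrite Dx rmorph_sum; apply: eq_bigr => i _.
  by rewrite ffunE Da rmorphM.
move=> c [Ec Dfx]; apply/ffunP => i; rewrite ffunE.
have /fin_all_exists2[a' Ea' Da'] j : exists2 a', a' \in E & f a' = c j.
  by have [a' Ea' Da'] := Ec j; exists a'.
rewrite -Da'; congr (f _).
apply: (mulIf (nzXi i)); apply/eqP; move: i isT; apply/forall_inP.
have Xmem (e : 'I_(\dim_E F) -> L) j :
    e j \in E -> e j * tnth X j \in (E * <[X`_j]>)%VS.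
  by move=> ej; rewrite memv_mul // XE memv_line.
move/directv_sum_unique: dxX => <- => [|j _|j _]; last 2 first.
- exact/Xmem/Ea.
- exact/Xmem/Ea'.
apply/eqP/(fmorph_inj f); transitivity (f x).
  by rewrite Dx; congr (f _); apply: eq_bigr => j _; rewrite Da.
rewrite Dfx rmorph_sum; apply: eq_bigr => j _.
by rewrite rmorphM Da'.
Qed.

(** A basis over Q in the sense of sets pulls back to a basis of F, so the degree
    over Q is well defined. *)
Lemma has_degree_dim (F : {subfield L}) n :
  has_degree (ratfield C) (f @` [set` F]) n -> \dim F = n.
Proof.
move=> [_ _ _ [b Fb cb]].
have /fin_all_exists2[b' Fb' Db'] j : exists2 b', b' \in F & f b' = b j.
  by have [b' ? ?] := Fb j; exists b'.
have fsum (k : 'I_n -> rat) :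
    f (\sum_i k i *: b' i) = \sum_i [ffun i => ratr (k i) : C] i * b i.
  rewrite rmorph_sum; apply: eq_bigr => i _.
  by rewrite ffunE -mulr_algl rmorphM rmorph_ratr Db'.
pose X := [tuple b' i | i < n].
have basX : basis_of F X.
  apply/andP; split.
    rewrite eqEsubv; apply/andP; split.
      by apply/span_subvP=> _ /tnthP[i ->]; rewrite tnth_mktuple.
    apply/subvP=> x Fx.
    have [c [[Qc Dx] _]] := cb (f x) (ex_intro2 _ _ x Fx erefl).
    have /fin_all_exists[k Dk] i : exists k, ratr k = c i.
      by have [k _ <-] := Qc i; exists k.
    have -> : x = \sum_i k i *: b' i.
      apply: (fmorph_inj f); rewrite fsum Dx; apply: eq_bigr => i _.
      by rewrite ffunE Dk.
    apply: memv_suml => i _; apply/memvZ/memv_span/tnthP.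
    by exists i; rewrite tnth_mktuple.
  (* Linear independence is the uniqueness of the coordinates of 0. *)
  apply/freeP=> k kX0 i.
  have F0 : (f @` [set` F]) 0 by exists 0; rewrite ?rmorph0 //=; exact: mem0v.
  have [c [_ uc]] := cb _ F0.
  have /ffunP/(_ i) :
      [ffun i => ratr (k i)] = [ffun i => ratr 0] :> {ffun 'I_n -> C}.
    transitivity c; first apply: esym; apply: uc; split.
    - by move=> j; rewrite ffunE; exists (k j).
    - rewrite -fsum -[LHS](rmorph0 f); congr (f _); rewrite -[LHS]kX0.
      by apply: eq_bigr => j _; rewrite -tnth_nth tnth_mktuple.
    - by move=> j; rewrite ffunE; exists 0.
    - by rewrite big1 // => j _; rewrite ffunE rmorph0 mul0r.
  by rewrite !ffunE => /fmorph_inj.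
exact: size_basis basX.
Qed.

End Image.

(** * The roots of unity on the unit circle *)

(** De Moivre's formula. *)
Lemma zetaX (R : realType) n k :
  zeta R n ^+ k = (cos (2 * pi / n%:R *+ k) +i* sin (2 * pi / n%:R *+ k))%C.
Proof.
rewrite /zeta; set a := _ / _.
elim: k => [|k IHk]; first by rewrite expr0 !mulr0n cos0 sin0.
rewrite exprSr IHk !mulrSr cosD sinD.
apply/eqP; rewrite eq_complex /=.
by apply/andP; split; apply/eqP; rewrite // addrC.
Qed.

(** If 0 < j < n, put x = pi j / n, so that zeta^j = cos (2 x) + i sin (2 x). It
    differs from 1 because cos (2 x) = 1 - 2 sin^2 x and sin x > 0 for x in the
    interval from 0 to pi. *)
Lemma zeta_prim_root (R : realType) n :
  (0 < n)%N -> n.-primitive_root (zeta R n).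
Proof.
move=> n_gt0; have n_neq0 : n%:R != 0 :> R by rewrite pnatr_eq0 -lt0n.
apply/andP; split=> //; apply/forallP=> i; rewrite unity_rootE zetaX; apply/eqP.
have [->|i_n] := eqVneq i.+1 n.
  by rewrite -mulr_natr divfK // mulr_natl cos2pi sin2pi eqxx.
set x : R := pi / n%:R *+ i.+1.
have -> : 2 * pi / n%:R *+ i.+1 = x *+ 2 :> R.
  by rewrite -mulrA mulr_natl -!mulrnA mulnC.
apply: contraTF isT => /eqP[]; rewrite cos_mulr2n cos2sin2 => cosx _.
have sinx : 0 < sin x.
  apply: sin_gt0_pi; rewrite /x -mulr_natr mulr_gt0 ?divr_gt0 ?ltr0n ?pi_gt0 //=.
  rewrite -mulrA gtr_pMr ?pi_gt0 // mulrC ltr_pdivrMr ?ltr0n // mul1r ltr_nat.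
  by rewrite ltn_neqAle i_n ltn_ord.
have : sin x ^+ 2 = 0 by lra.
by move/eqP; rewrite sqrf_eq0 gt_eqF.
Qed.

Lemma zeta_exp (R : realType) n d :
  (0 < d)%N -> zeta R (n * d) ^+ d = zeta R n.
Proof.
move=> d_gt0; have d_neq0 : d%:R != 0 :> R by rewrite pnatr_eq0 -lt0n.
by rewrite zetaX /zeta -mulr_natr natrM invfM mulrA divfK.
Qed.

Lemma zeta_ppower_exp (R : realType) l m M : prime l -> (m <= M)%N ->
  zeta R (l ^ M) ^+ (l ^ (M - m)) = zeta R (l ^ m).
Proof.
move=> l_pr le_mM; rewrite -{1}(subnK le_mM) addnC expnD zeta_exp //.
by rewrite expn_gt0 prime_gt0.
Qed.

(** * The degrees *)

Definition Afield_degree (k l m : nat) : nat :=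
  (totient (l ^ m) %/ gcdn (k - 1) (totient (l ^ m)))%N.

(** Write a = a' * l^v with a' prime to l. As l.-1 is prime to l as well, the gcd
    of a and l.-1 * l^m is gcd (a', l.-1) * l^(min (v, m)), and gcd (a', l.-1)
    is gcd (a, l.-1). *)
Lemma totient_ppower_div_gcd (a l m : nat) : (0 < a)%N -> prime l ->
  (totient (l ^ m.+1) %/ gcdn a (totient (l ^ m.+1)) =
    l.-1 %/ gcdn a l.-1 * l ^ (m - logn l a))%N.
Proof.
move=> a_gt0 l_pr; rewrite totient_pfactor //=.
have l_gt0 := prime_gt0 l_pr.
have co_l : coprime l l.-1 by rewrite -{1}(prednK l_gt0) coprimeSn.
have co_lX d : coprime l.-1 (l ^ d) by rewrite coprime_sym coprimeXl.
have [a' co_a Da] := pfactor_coprime l_pr a_gt0; set v := logn l a in Da *.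
have co_aX d : coprime a' (l ^ d) by rewrite coprime_sym coprimeXl.
have gE d : gcdn (a' * l ^ d) l.-1 = gcdn a' l.-1.
  by rewrite gcdnC Gauss_gcdl // gcdnC.
have lX_gt0 d : (0 < l ^ d)%N by rewrite expn_gt0 l_gt0.
rewrite Da gE; set g := gcdn a' l.-1.
have dv_g : (g %| l.-1)%N by exact: dvdn_gcdr.
case: (leqP v m) => [le_vm | lt_mv].
  rewrite -{1 2}(subnK le_vm) expnD mulnA -muln_gcdl Gauss_gcdl //.
  by rewrite divnMr // -/g divn_mulAC.
rewrite -{1}(subnK (ltnW lt_mv)) expnD mulnA -muln_gcdl gE divnMr //.
by rewrite (eqP (ltnW lt_mv)) expn0 muln1.
Qed.

(** * The fields A at one cyclotomic level *)

Section PrimePowerLevel.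

Variables (R : realType) (k l M : nat).
Hypotheses (k_gt1 : (1 < k)%N) (k_even : ~~ odd k) (l_pr : prime l).
Variables (L : splittingFieldType rat) (f : {rmorphism L -> R[i]}) (w : L).
Hypotheses (fw : f w = zeta R (l ^ M.+1)) (gen_w : <<1; w>>%VS = fullv).
Hypothesis dimL : \dim {:L} = totient (l ^ M.+1).

Let k1_gt0 : (0 < k - 1)%N. Proof. by rewrite subn_gt0. Qed.

Lemma odd_level_cyclic : odd l -> cyclic 'Gal({:L} / 1)%g.
Proof.
move=> l_odd; apply: (cyclotomic_gal_cyclic (m := M) l_pr l_odd _ gen_w).
rewrite -(fmorph_primitive_root f) fw; apply: zeta_prim_root.
by rewrite expn_gt0 prime_gt0.
Qed.

(** For l = 2 the constant in the degree formula is 1 because l.-1 = 1, and the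
    2-adic valuation of k - 1 is 0 because k - 1 is odd. *)
Lemma Afield_degree_even m :
  ~~ odd l -> Afield_degree k l m.+1 = totient (l ^ m.+1).
Proof.
move=> l_even; have l2 : l = 2%N.
  by case: (even_prime l_pr) l_even => // ->.
rewrite /Afield_degree totient_ppower_div_gcd // l2 /= gcdn1 divn1 mul1n.
rewrite totient_pfactor //= mul1n lognE dvdn2 k1_gt0 /=.
by rewrite oddB ?(ltnW k_gt1) // (negPf k_even) subn0.
Qed.

(** Fields of all lower levels are captured as well, which is what allows two
    consecutive ones to be compared. *)
Lemma Afield_preimage m (K : set R[i]) : (m <= M)%N -> is_Afield k l m.+1 K ->
  exists E : {subfield L}, K = f @` [set` E] /\ \dim E = Afield_degree k l m.+1.
Proof.
move=> le_mM [subK K_zeta degK].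
have K_f : K `<=` range f.
  apply: subset_trans K_zeta _; apply: smallest_sub.
    by rewrite range_image; exact: subfield_image.
  move=> _ ->; exists (w ^+ (l ^ (M.+1 - m.+1))) => //.
  by rewrite rmorphXn fw zeta_ppower_exp.
have [E KE] := subfield_preimage subK K_f; exists E; split=> //.
by apply: (@has_degree_dim _ _ f); rewrite -KE.
Qed.

Lemma Afield_exists : exists K : set R[i], is_Afield k l M.+1 K.
Proof.
suffices [E dimE] : exists E : {subfield L}, \dim E = Afield_degree k l M.+1.
  exists (f @` [set` E]); split; first exact: subfield_image.
    by rewrite -fw Qadjoin_image // => _ [x _ <-]; exists x.
  rewrite (ratfield_image f) -/(Afield_degree k l M.+1) -dimE.
  have := has_degree_image f (sub1v E).
  by rewrite dimv1 divn1.
have [l_odd|l_even] := boolP (odd l); last first.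
  by exists {:L}%AS; rewrite Afield_degree_even.
have dv : (Afield_degree k l M.+1 %| \dim_(1%AS : {subfield L}) {:L})%N.
  by rewrite dimv1 divn1 dimL /Afield_degree dvdn_div ?dvdn_gcdr.
have [E [_ dimE]] :=
  cyclic_galois_dim (galois_rat L) (odd_level_cyclic l_odd) dv.
by exists E; rewrite -dimE dimv1 divn1.
Qed.

(** For odd l the degrees divide one another and the Galois group is cyclic; for
    l = 2 the larger field is everything. *)
Lemma subv_of_Afield_degree m (E1 E2 : {subfield L}) : (m <= M)%N ->
  \dim E1 = Afield_degree k l m.+1 -> \dim E2 = Afield_degree k l M.+1 ->
  (E1 <= E2)%VS.
Proof.
move=> le_mM dim1 dim2; have [l_odd|l_even] := boolP (odd l); last first.
  have /eqP-> : (E2 == fullv :> {vspace L})%VS.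
    by rewrite eqEdim subvf dim2 Afield_degree_even // dimL leqnn.
  exact: subvf.
have cyc := odd_level_cyclic l_odd.
apply: (cyclic_galois_subv (galois_rat L) cyc); rewrite ?sub1v ?subvf //.
rewrite dim1 dim2 /Afield_degree !totient_ppower_div_gcd //.
by rewrite dvdn_mul // dvdn_exp2l // leq_sub2r.
Qed.

End PrimePowerLevel.

(** * The tower *)

Lemma zeta_level (R : realType) l M : prime l ->
  exists (L : splittingFieldType rat) (f : {rmorphism L -> R[i]}) (w : L),
    [/\ f w = zeta R (l ^ M), <<1; w>>%VS = fullv
      & \dim {:L} = totient (l ^ M)].
Proof.
move=> l_pr; apply: cyclotomic_field; apply: zeta_prim_root.
by rewrite expn_gt0 prime_gt0.
Qed.

(** The choice defining the field is made from a nonempty set, since a field of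
    the required degree exists inside the cyclotomic field of the same level. *)
Lemma AfieldP (R : realType) k l m :
    (1 < k)%N -> ~~ odd k -> prime l ->
  is_Afield k l m.+1 (Afield R k l m.+1).
Proof.
move=> k_gt1 k_even l_pr.
have [L [f [w [fw gen_w dimL]]]] := zeta_level R m.+1 l_pr.
have [K AK] := Afield_exists k_gt1 k_even l_pr fw gen_w dimL.
exact: (@xgetPex _ set0 [set K | is_Afield k l m.+1 K] (ex_intro _ K AK)).
Qed.

(** Both fields are placed in the cyclotomic field of the larger one. *)
Lemma Afield_tower (R : realType) k l m :
    (1 < k)%N -> ~~ odd k -> prime l ->
  exists (L : splittingFieldType rat) (f : {rmorphism L -> R[i]})
         (E1 E2 : {subfield L}),
    [/\ Afield R k l m.+1 = f @` [set` E1] /\ \dim E1 = Afield_degree k l m.+1,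
        Afield R k l m.+2 = f @` [set` E2] /\ \dim E2 = Afield_degree k l m.+2
      & (E1 <= E2)%VS].
Proof.
move=> k_gt1 k_even l_pr.
have [L [f [w [fw gen_w dimL]]]] := zeta_level R m.+2 l_pr.
have [E1 [A1 dim1]] := Afield_preimage l_pr fw (leqnSn m)
  (AfieldP R m k_gt1 k_even l_pr).
have [E2 [A2 dim2]] := Afield_preimage l_pr fw (leqnn m.+1)
  (AfieldP R m.+1 k_gt1 k_even l_pr).
exists L, f, E1, E2; split=> //.
exact: (subv_of_Afield_degree k_gt1 k_even l_pr fw gen_w dimL (leqnSn m)).
Qed.

Theorem lemma3 (R : realType) (k : nat) (k_ge4 : (4 <= k)%N)
    (k_even : ~~ odd k) (l : nat) (l_prime : prime l) :
  [/\ forall m : nat, (0 < m)%N ->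
        Afield R k l m `<=` Afield R k l m.+1,
      forall m : nat, (0 < m)%N -> (m <= logn l (k - 1) + 1)%N ->
        Afield R k l m = Afield R k l 1 &
      forall m : nat, (logn l (k - 1) + 1 <= m)%N ->
        has_degree (Afield R k l m) (Afield R k l m.+1) l].
Proof.
have k_gt1 : (1 < k)%N by apply: leq_trans k_ge4.
have k1_gt0 : (0 < k - 1)%N by rewrite subn_gt0.
have tower m := Afield_tower R m k_gt1 k_even l_prime.
split=> [[//|m] _|m m_gt0|[|m]].
- have [L [f [E1 [E2 [[-> _] [-> _] le_E]]]]] := tower m.
  exact: image_subv.
- (* Below the threshold both truncated exponents of l are 0. *)
  case: m m_gt0 => // m _; elim: m => // m IHm; rewrite addn1 ltnS => lt_mv.
  transitivity (Afield R k l m.+1); last by apply: IHm; rewrite addn1 ltnS ltnW.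
  have [L [f [E1 [E2 [[-> dim1] [-> dim2] le_E]]]]] := tower m.
  have dimE : \dim E1 = \dim E2.
    rewrite dim1 dim2 /Afield_degree !totient_ppower_div_gcd //.
    by rewrite (eqP lt_mv) (eqP (ltnW lt_mv)).
  have /eqP-> // : (E1 == E2 :> {vspace L})%VS.
  by rewrite eqEdim le_E dimE /=.
- by rewrite addn1.
rewrite addn1 ltnS => le_vm.
have [L [f [E1 [E2 [[-> dim1] [-> dim2] le_E]]]]] := tower m.
have <- : \dim_E1 E2 = l; last exact: has_degree_image.
have := adim_gt0 E1; rewrite dim1 dim2 /Afield_degree !totient_ppower_div_gcd //.
by rewrite subSn // expnS mulnCA => d_gt0; rewrite mulnK.
Qed.
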